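(* Let $G$ be a finite simple graph that is $(P_2\cup P_4)$-free, diamond-free and $C_5$-free, with $\omega(G)\ge 5$. Then $G$ is perfect.
   Context: $P_t$ denotes the path and $C_t$ the cycle on $t$ vertices. For vertex-disjoint graphs $G_1,G_2$, $G_1\cup G_2$ is their disjoint union (no edges between them). A graph $G$ is $H$-free if no induced subgraph of $G$ is isomorphic to $H$. A diamond is the graph obtained from a $P_3$ by adding a new vertex adjacent to all three vertices of the $P_3$. $\omega(G)$ is the clique number. A graph is perfect if $\chi(H)=\omega(H)$ for every induced subgraph $H$. *)

(* Defs.v *)
From mathcomp Require Import all_boot.

Set Implicit Arguments.
Unset Strict Implicit.
Unset Printing Implicit Defensive.

Record sgraph := SGraph {
  vertex :> finType;
  adj : rel vertex;
  adj_sym : symmetric adj;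
  adj_irrefl : irreflexive adj
}.

Definition isomorphic (G H : sgraph) : Prop :=
  exists2 f : G -> H, bijective f & forall x y, adj (f x) (f y) = adj x y.

Section Induced.
Variables (G : sgraph) (S : {set G}).

Definition induced_adj : rel {x : G | x \in S} :=
  fun u v => adj (val u) (val v).

Lemma induced_adj_sym : symmetric induced_adj.
Proof. by move=> u v; apply: adj_sym. Qed.

Lemma induced_adj_irrefl : irreflexive induced_adj.
Proof. by move=> u; apply: adj_irrefl. Qed.

Definition induced : sgraph := SGraph induced_adj_sym induced_adj_irrefl.
End Induced.

Definition free (H G : sgraph) : Prop :=
  forall S : {set G}, ~ isomorphic (induced S) H.

Section PathCycle.
Variable t : nat.

Definition path_adj : rel 'I_t :=
  fun i j => (i.+1 == j :> nat) || (j.+1 == i :> nat).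

Lemma path_adj_sym : symmetric path_adj.
Proof. by move=> i j; rewrite /path_adj orbC. Qed.

Lemma path_adj_irrefl : irreflexive path_adj.
Proof. by move=> i; rewrite /path_adj orbb gtn_eqF. Qed.

Definition path_graph : sgraph := SGraph path_adj_sym path_adj_irrefl.

(* The condition i != j only matters for t = 1, where it excludes a loop. *)
Definition cycle_adj : rel 'I_t :=
  fun i j => (i != j) &&
    ((i.+1 %% t == j :> nat) || (j.+1 %% t == i :> nat)).

Lemma cycle_adj_sym : symmetric cycle_adj.
Proof. by move=> i j; rewrite /cycle_adj eq_sym orbC. Qed.

Lemma cycle_adj_irrefl : irreflexive cycle_adj.
Proof. by move=> i; rewrite /cycle_adj eqxx. Qed.

Definition cycle_graph : sgraph := SGraph cycle_adj_sym cycle_adj_irrefl.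
End PathCycle.

Section DisjointUnion.
Variables G1 G2 : sgraph.

Definition union_adj : rel (G1 + G2)%type := fun u v =>
  match u, v with
  | inl x, inl y => adj x y
  | inr x, inr y => adj x y
  | _, _ => false
  end.

Lemma union_adj_sym : symmetric union_adj.
Proof. by move=> [x|x] [y|y] //=; apply: adj_sym. Qed.

Lemma union_adj_irrefl : irreflexive union_adj.
Proof. by move=> [x|x] /=; apply: adj_irrefl. Qed.

Definition disjoint_union : sgraph := SGraph union_adj_sym union_adj_irrefl.
End DisjointUnion.

(* None is a new vertex, adjacent to every vertex of G. *)
Section Cone.
Variable G : sgraph.

Definition cone_adj : rel (option G) := fun u v =>
  match u, v with
  | Some x, Some y => adj x y
  | None, None => false
  | _, _ => true
  end.

Lemma cone_adj_sym : symmetric cone_adj.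
Proof. by move=> [x|] [y|] //=; apply: adj_sym. Qed.

Lemma cone_adj_irrefl : irreflexive cone_adj.
Proof. by move=> [x|] //=; apply: adj_irrefl. Qed.

Definition cone : sgraph := SGraph cone_adj_sym cone_adj_irrefl.
End Cone.

Definition diamond : sgraph := cone (path_graph 3).

Section Invariants.
Variable G : sgraph.

Definition clique (S : {set G}) : bool :=
  [forall x in S, forall y in S, (x != y) ==> adj x y].

Definition omega : nat := \max_(S : {set G} | clique S) #|S|.

Definition proper_coloring k (c : {ffun G -> 'I_k}) : bool :=
  [forall x, forall y, adj x y ==> (c x != c y)].

Definition colorable k : bool := [exists c : {ffun G -> 'I_k}, proper_coloring c].

Lemma colorable_card : colorable #|G|.
Proof.
apply/existsP; exists [ffun x => enum_rank x].
apply/forallP=> x; apply/forallP=> y; apply/implyP=> xy.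
by rewrite !ffunE (inj_eq enum_rank_inj); apply: contraTneq xy => ->; rewrite adj_irrefl.
Qed.

Definition chi : nat := ex_minn (ex_intro (fun k => colorable k) _ colorable_card).
End Invariants.

Definition perfect (G : sgraph) : Prop :=
  forall S : {set G}, chi (induced S) = omega (induced S).

(* Main.v *)
Require Import Defs.
From mathcomp Require Import all_boot.

Set Implicit Arguments.
Unset Strict Implicit.
Unset Printing Implicit Defensive.

(** A graph is perfect as soon as every nonempty induced subgraph [S] has a stable
    set meeting all of its maximum cliques, since such a set can serve as a colour
    class. Fix a maximum clique [K]. Diamond-freeness gives every vertex outside
    [K] at most one neighbour in [K], its foot, and C5-freeness forces the middle
    of an induced P3 whose ends have distinct feet to share one of them. As [K]
    has at least 5 vertices, it follows that no P4 avoids [K].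

    Inside [S], start from one vertex of [K], if any, and add vertices in the parts
    of the P4-free remainder. Disconnected parts are independent of each other.
    By Seinsche's theorem a connected part is a join, hence, without diamonds,
    complete bipartite or dominated by a vertex [c]. If the maximum cliques of [S]
    have at least 3 vertices, then [c] belongs to all those meeting a dominated
    part, while each one meeting a bipartite part has a vertex on either side and
    one in [K]. If they are edges, all feet of a side of a bipartite part coincide
    and differ from those of the other side, so that one of the sides can be
    chosen. *)

Lemma leq_card_setU2 (T : finType) (A B : {set T}) m n :
  #|A| <= m -> #|B| <= n -> #|A :|: B| <= m + n.
Proof.
by move=> leA leB; apply: leq_trans (leq_card_setU A B).1 _; apply: leq_add.
Qed.

Section Embeddings.

Variables H G : sgraph.

Lemma embedding_not_free (f : H -> G) :
  injective f -> (forall x y, adj (f x) (f y) = adj x y) -> ~ free H G.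
Proof.
move=> injf adjf /(_ (f @: [set: H])); apply.
have memf x : f x \in f @: [set: H] by rewrite imset_f ?inE.
pose h x : induced (f @: [set: H]) := exist _ (f x) (memf x).
have injh : injective h by move=> x y /(congr1 val) /injf.
have [|g gK hK] := @inj_card_bij _ _ h injh.
  rewrite card_sig -(card_imset predT injf); apply/subset_leq_card/subsetP => x.
  by rewrite !inE => /imsetP [y _ ->]; rewrite imset_f.
exists g; first by exists h.
by move=> x y; rewrite -adjf -[in RHS](hK x) -[in RHS](hK y).
Qed.

Definition twin_free := forall x y : H, adj x =1 adj y -> x = y.

Lemma twin_free_embedding_inj (f : H -> G) :
  twin_free -> (forall x y, adj (f x) (f y) = adj x y) -> injective f.
Proof. by move=> twin adjf x y fxy; apply: twin => z; rewrite -!adjf fxy. Qed.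

End Embeddings.

Lemma cycle5_twin_free : twin_free (cycle_graph 5).
Proof.
move=> x y adjxy; move: (adjxy (@Ordinal 5 0 isT)) (adjxy (@Ordinal 5 1 isT))
  (adjxy (@Ordinal 5 2 isT)) (adjxy (@Ordinal 5 3 isT)) => {adjxy}.
case: x y => [[|[|[|[|[|i]]]]] ltx] [[|[|[|[|[|j]]]]] lty] //= *; exact: val_inj.
Qed.

Lemma P2P4_twin_free : twin_free (disjoint_union (path_graph 2) (path_graph 4)).
Proof.
move=> x y adjxy.
move: (adjxy (inl (@Ordinal 2 0 isT))) (adjxy (inl (@Ordinal 2 1 isT)))
  (adjxy (inr (@Ordinal 4 0 isT))) (adjxy (inr (@Ordinal 4 1 isT)))
  (adjxy (inr (@Ordinal 4 2 isT))) (adjxy (inr (@Ordinal 4 3 isT))) => {adjxy}.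
case: x y => [[[|[|i]] ltx]|[[|[|[|[|i]]]] ltx]]
             [[[|[|j]] lty]|[[|[|[|[|j]]]] lty]] //= *; congr (_ _); exact: val_inj.
Qed.

Section InducedP4.

Variables (V : finType) (e : rel V).

Definition induced_P4 p q r s :=
  [&& e p q, e q r, e r s, ~~ e p r, ~~ e q s & ~~ e p s].

Definition P4_free_on (T : {set V}) :=
  forall p q r s, all [in T] [:: p; q; r; s] -> ~~ induced_P4 p q r s.

Lemma P4_free_onS (T T' : {set V}) : T' \subset T -> P4_free_on T -> P4_free_on T'.
Proof.
by move=> /subsetP T'T P4T p q r s pqrs; apply: P4T; apply: sub_all pqrs => u /T'T.
Qed.

End InducedP4.

Section ForbiddenSubgraphs.

Variable G : sgraph.
Implicit Types a b c d x y p q r s : G.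

Lemma diamond_free_adj a b x y :
  free diamond G -> adj a b -> adj a x -> adj b x -> adj a y -> adj b y ->
  x != y -> adj x y.
Proof.
move=> diaG ab ax bx ay by_ neq_xy; apply/idPn=> /negbTE nxy.
pose f (z : diamond) : G :=
  if z is Some i then nth a [:: x; b; y] (val (i : 'I_3)) else a.
have adjf u v : adj (f u) (f v) = adj u v.
  case: u v => [[[|[|[|i]]] ltu]|] [[[|[|[|j]]] ltv]|] //=; rewrite /f /=;
  rewrite ?adj_irrefl // ?ab ?ax ?bx ?ay ?by_ ?nxy //
    adj_sym ?ab ?ax ?bx ?ay ?by_ ?nxy //.
apply: (embedding_not_free _ adjf diaG) => u v fuv.
have adjuv z : adj u z = adj v z by rewrite -!adjf fuv.
move: fuv (adjuv None) (adjuv (Some (@Ordinal 3 1 isT))) => {adjuv}.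
case: u v => [[[|[|[|i]]] ltu]|] [[[|[|[|j]]] ltv]|] //=;
  rewrite /f /= => fuv _ _; try (by congr Some; apply: val_inj);
  by rewrite fuv eqxx in neq_xy.
Qed.

Lemma C5_free_chord a b c d e :
  free (cycle_graph 5) G ->
  adj a b -> adj b c -> adj c d -> adj d e -> adj e a ->
  [|| adj a c, adj a d, adj b d, adj b e | adj c e].
Proof.
move=> C5G ab bc cd de ea; apply/idPn; rewrite !negb_or.
move=> /and5P [/negbTE ac /negbTE ad /negbTE bd /negbTE be /negbTE ce].
pose f (z : cycle_graph 5) : G := nth a [:: a; b; c; d; e] (val (z : 'I_5)).
have adjf u v : adj (f u) (f v) = adj u v.
  case: u v => [[|[|[|[|[|i]]]]] ltu] [[|[|[|[|[|j]]]]] ltv] //; rewrite /f /=;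
  rewrite ?adj_irrefl ?ab ?bc ?cd ?de ?ea ?ac ?ad ?bd ?be ?ce //
    adj_sym ?ab ?bc ?cd ?de ?ea ?ac ?ad ?bd ?be ?ce //.
exact: embedding_not_free (twin_free_embedding_inj cycle5_twin_free adjf) adjf C5G.
Qed.

Lemma P2P4_free_linked a b p q r s :
  free (disjoint_union (path_graph 2) (path_graph 4)) G ->
  adj a b -> induced_P4 (@adj G) p q r s ->
  ~~ allrel (fun x y => ~~ adj x y) [:: a; b] [:: p; q; r; s].
Proof.
move=> PG ab /and5P [pq qr rs /negbTE pr /andP [/negbTE qs /negbTE ps]].
apply/negP=> /allrelP apart.
pose f (z : disjoint_union (path_graph 2) (path_graph 4)) : G :=
  match z with
  | inl i => nth a [:: a; b] (val (i : 'I_2))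
  | inr i => nth p [:: p; q; r; s] (val (i : 'I_4))
  end.
have apartE i j : i < 2 -> j < 4 ->
    adj (nth a [:: a; b] i) (nth p [:: p; q; r; s] j) = false.
  by move=> lti ltj; apply/negbTE/apart; apply: mem_nth.
have adjf u v : adj (f u) (f v) = adj u v.
  case: u v => [[i lti]|[i lti]] [[j ltj]|[j ltj]]; rewrite /f.
  - case: i j lti ltj => [|[|i]] [|[|j]] lti ltj //=; rewrite ?adj_irrefl ?ab //.
    by rewrite adj_sym ab.
  - exact: apartE.
  - by rewrite adj_sym apartE.
  - case: i j lti ltj => [|[|[|[|i]]]] [|[|[|[|j]]]] lti ltj //=;
    rewrite ?adj_irrefl ?pq ?qr ?rs ?pr ?ps ?qs //
      adj_sym ?pq ?qr ?rs ?pr ?ps ?qs //.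
exact: embedding_not_free (twin_free_embedding_inj P2P4_twin_free adjf) adjf PG.
Qed.

End ForbiddenSubgraphs.

Section HomogeneousCuts.

Variable V : finType.
Implicit Types (e : rel V) (T A : {set V}).

Definition homogeneous_cut e T b A :=
  [/\ A \proper T, A != set0 & {in A & T :\: A, forall x y, e x y = b}].

Lemma homogeneous_cutC e T b A :
  symmetric e -> homogeneous_cut e T b A -> homogeneous_cut e T b (T :\: A).
Proof.
move=> sym_e [/properP [AT [y yT yA]] /set0Pn [z zA] eA]; split.
- apply/properP; split; first exact: subsetDl.
  by exists z; [exact: subsetP AT z zA | rewrite inE zA].
- by apply/set0Pn; exists y; rewrite inE yA.
- move=> x u xTA; rewrite setDDr setDv set0U (setIidPr AT) => uA.
  by rewrite sym_e eA.
Qed.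

Definition compl_rel e : rel V := fun x y => (x != y) && ~~ e x y.

Lemma compl_rel_sym e : symmetric e -> symmetric (compl_rel e).
Proof. by move=> sym_e x y; rewrite /compl_rel eq_sym sym_e. Qed.

Lemma P4_free_on_compl e T :
  symmetric e -> P4_free_on e T -> P4_free_on (compl_rel e) T.
Proof.
move=> sym_e P4T p q r s /and5P [pT qT rT sT _]; apply/negP.
rewrite /induced_P4 /compl_rel !negb_and !negbK.
case/and5P => /andP [pq npq] /andP [qr nqr] /andP [rs nrs] pr /andP [qs ps].
have {}pr : e p r.
  by case: eqVneq pr => // pr _; rewrite pr (negbTE rs) (negbTE nrs) in ps.
have {}qs : e q s.
  by case: eqVneq qs => // qs _; rewrite -qs (negbTE pq) (negbTE npq) in ps.
have {}ps : e p s.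
  by case: eqVneq ps => // ps _; rewrite -ps sym_e pr in nrs.
apply: (negP (P4T q s p r _)); first by rewrite /= qT sT pT rT.
by rewrite /induced_P4 qs pr (sym_e s p) ps (sym_e q p) npq (sym_e s r) nrs nqr.
Qed.

Lemma homogeneous_cut_compl e T b A :
  homogeneous_cut (compl_rel e) T b A -> homogeneous_cut e T (~~ b) A.
Proof.
move=> [AT A0 cA]; split=> // x y xA /[dup] yTA /setDP [_ yA].
have xy : x != y by apply: contraNneq yA => <-.
by rewrite -(cA x y xA yTA) /compl_rel xy negbK.
Qed.

Lemma P4_free_cut_or_complete e T x A :
  symmetric e -> P4_free_on e T -> x \in T -> homogeneous_cut e (T :\ x) false A ->
  (exists A', homogeneous_cut e T false A') \/ {in A, forall u, e x u}.
Proof.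
move=> sym_e P4T xT cutA.
have [/properP [ATx [y yTx yA]] _ eA] := cutA.
have memA u : u \in A -> u \in T /\ u != x.
  by move=> /(subsetP ATx) /setD1P [].
have [/exists_inP [z zB xz]|/exists_inPn isolated] :=
  boolP [exists z in (T :\ x) :\: A, e x z]; last first.
  left; have [BTx B0 eB] := homogeneous_cutC sym_e cutA.
  exists (T :\ x :\: A); split=> //.
    exact: proper_sub_trans BTx (subD1set T x).
  move=> u v uB /setDP [vT vB]; have [->|vx] := eqVneq v x.
    by rewrite sym_e; apply/negbTE/isolated.
  by apply: eB; rewrite // inE vB !inE vx.
have [/forall_inP|/forall_inPn [u0 u0A nxu0]] := boolP [forall u in A, e x u].
  by right.
left; exists [set u in A | ~~ e x u]; split.
- apply/properP; split; first by apply/subsetP=> u; rewrite inE => /andP [/memA []].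
  by exists x; rewrite // inE; apply/negP => /andP [/(subsetP ATx)]; rewrite setD11.
- by apply/set0Pn; exists u0; rewrite inE u0A.
move=> u v; rewrite !inE => /andP [uA nxu] /andP [vA' vT].
have [->|vx] := eqVneq v x; first by rewrite sym_e (negbTE nxu).
have [vA|nvA] := boolP (v \in A); last by apply: eA; rewrite // !inE nvA vx.
move: vA'; rewrite vA negbK => xv; apply/negbTE/negP => uv.
have zT : z \in T by move: zB; rewrite !inE => /and3P [].
apply: (negP (P4T z x v u _)); first by rewrite /= zT xT vT (memA u uA).1.
by rewrite /induced_P4 sym_e xz xv sym_e uv sym_e eA // nxu sym_e eA.
Qed.

Lemma P4_free_extend_cut e T x A :
  symmetric e -> P4_free_on e T -> x \in T -> homogeneous_cut e (T :\ x) false A ->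
  exists b A', homogeneous_cut e T b A'.
Proof.
move=> sym_e P4T xT cutA; have cutB := homogeneous_cutC sym_e cutA.
have [|xA] := P4_free_cut_or_complete sym_e P4T xT cutA; first by exists false.
have [|xB] := P4_free_cut_or_complete sym_e P4T xT cutB; first by exists false.
have [/properP [ATx [y /setD1P [yx yT] _]] _ _] := cutA.
exists true, [set x]; split.
- by apply/properP; split; [rewrite sub1set|exists y; rewrite ?inE].
- by apply/set0Pn; exists x; rewrite inE.
move=> _ z /set1P -> zTx; have [zA|zA] := boolP (z \in A); first exact: xA.
by apply: xB; rewrite inE zA.
Qed.

(* Seinsche's theorem: the graph is disconnected if b = false, and its complement
   is if b = true. *)
Lemma P4_free_homogeneous_cut e T :
  symmetric e -> 1 < #|T| -> P4_free_on e T -> exists b A, homogeneous_cut e T b A.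
Proof.
move=> sym_e; have [n] := ubnP #|T|; elim: n T => // n IHn T leTn T1 P4T.
have /card_gt0P [x xT] := ltnW T1.
have cardT := cardsD1 x T; rewrite xT add1n in cardT.
have [le1|gt1] := leqP #|T :\ x| 1.
  have /cards1P [y Ty] : #|T :\ x| == 1 by rewrite eqn_leq le1 -ltnS -cardT.
  exists (e x y), [set x]; split.
  - by rewrite properEcard sub1set xT cards1.
  - by rewrite -card_gt0 cards1.
  - by move=> _ z /set1P ->; rewrite Ty => /set1P ->.
have [|b [A cutA]] := IHn (T :\ x) _ gt1 (P4_free_onS (subD1set T x) P4T).
  by rewrite -ltnS -cardT.
case: b cutA => [[AT A0 eA]|cutA]; last exact: P4_free_extend_cut cutA.
have [|b [A' cutA']] := @P4_free_extend_cut (compl_rel e) T x A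
    (compl_rel_sym sym_e) (P4_free_on_compl sym_e P4T) xT.
  by split=> // u v uA vB; rewrite /compl_rel eA // andbF.
by exists (~~ b), A'; apply: homogeneous_cut_compl.
Qed.

End HomogeneousCuts.

Section CliquesAndStableSets.

Variable G : sgraph.
Implicit Types (x y u v c : G) (A B C K S T X Y : {set G}).

Definition anticomplete A B := {in A & B, forall x y, ~~ adj x y}.

Definition complete A B := {in A & B, forall x y, adj x y}.

Definition dominates c T := {in T, forall z, z != c -> adj c z}.

Definition stable A : bool := [forall x in A, forall y in A, ~~ adj x y].

Lemma anticompleteC A B : anticomplete A B -> anticomplete B A.
Proof. by move=> AB x y xB yA; rewrite adj_sym AB. Qed.

Lemma completeC A B : complete A B -> complete B A.
Proof. by move=> AB x y xB yA; rewrite adj_sym AB. Qed.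

Lemma adj_or_anticomplete A B :
  (exists2 x, x \in A & exists2 y, y \in B & adj x y) \/ anticomplete A B.
Proof.
have [/exists_inP [x xA /exists_inP ?]|/exists_inPn AB] :=
  boolP [exists x in A, exists y in B, adj x y]; first by left; exists x.
by right=> x y /AB /exists_inPn xB /xB.
Qed.

Lemma stableP A : reflect (anticomplete A A) (stable A).
Proof.
apply: (iffP forall_inP) => [h x y xA yA|h x xA]; first exact: (forall_inP (h x xA)).
by apply/forall_inP => y; apply: h.
Qed.

Lemma stable0 : stable set0.
Proof. by apply/stableP => x y; rewrite inE. Qed.

Lemma stable1 x : stable [set x].
Proof. by apply/stableP => y z /set1P -> /set1P ->; rewrite adj_irrefl. Qed.

Lemma sub_stable A B : A \subset B -> stable B -> stable A.
Proof.
by move=> /subsetP AB /stableP sB; apply/stableP => x y /AB xB /AB; apply: sB.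
Qed.

Lemma stableU A B :
  stable A -> stable B -> anticomplete A B -> stable (A :|: B).
Proof.
move=> /stableP sA /stableP sB AB; apply/stableP => x y.
move=> /setUP [xA|xB] /setUP [yA|yB]; [exact: sA|exact: AB| |exact: sB].
by rewrite adj_sym AB.
Qed.

Definition complete_bipartite X Y := [/\ stable X, stable Y & complete X Y].

Lemma complete_bipartiteC X Y : complete_bipartite X Y -> complete_bipartite Y X.
Proof. by case=> sX sY /completeC. Qed.

Lemma cliqueP C : reflect {in C &, forall x y, x != y -> adj x y} (clique C).
Proof.
apply: (iffP forall_inP) => [h x y xC yC|h x xC].
  exact/implyP/(forall_inP (h x xC)).
by apply/forall_inP=> y yC; apply/implyP/h.
Qed.

Lemma adj_neq x y : adj x y -> x != y.
Proof. by apply: contraTneq => ->; rewrite adj_irrefl. Qed.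

Definition nbrs_in K u := K :&: [set v | adj u v].

Lemma nbrs_in_uniq K u v v' :
  #|nbrs_in K u| <= 1 -> v \in K -> v' \in K -> adj u v -> adj u v' -> v = v'.
Proof.
by move=> /card_le1_eqP uniq vK v'K uv uv'; apply: uniq; rewrite !inE ?vK ?v'K.
Qed.

Lemma sub_clique C K : C \subset K -> clique K -> clique C.
Proof.
by move=> /subsetP CK /cliqueP cK; apply/cliqueP=> x y /CK xK /CK yK; apply: cK.
Qed.

Lemma clique1 x : clique [set x].
Proof. by apply/cliqueP=> y z /set1P -> /set1P ->; rewrite eqxx. Qed.

Lemma clique_setU1 C x :
  clique C -> {in C, forall y, y != x -> adj x y} -> clique (x |: C).
Proof.
move=> /cliqueP cC xC; apply/cliqueP=> y z.
move=> /setU1P [->|yC] /setU1P [->|zC] neq; first by rewrite eqxx in neq.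
- by apply: xC; rewrite // eq_sym.
- by rewrite adj_sym; apply: xC.
- exact: cC.
Qed.

Lemma clique2 x y : adj x y -> clique [set x; y].
Proof. by move=> xy; apply: clique_setU1 (clique1 y) _ => z /set1P ->. Qed.

Lemma clique3 x y z : adj x y -> adj x z -> adj y z -> clique (x |: [set y; z]).
Proof.
by move=> xy xz yz; apply: clique_setU1 (clique2 yz) _ => u /set2P [] ->.
Qed.

Lemma clique_stable_card_le1 C A : clique C -> stable A -> #|C :&: A| <= 1.
Proof.
move=> /cliqueP cC /stableP sA; apply/card_le1_eqP => x y.
move=> /setIP [xC xA] /setIP [yC yA]; apply/esym/eqP; apply: contraNT (sA x y xA yA).
exact: cC.
Qed.

Definition maximal_stable_in K B :=
  [/\ B \subset K, stable B & {in K :\: B, forall x, exists2 y, y \in B & adj x y}].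

Lemma maximal_stable_exists K : exists B, maximal_stable_in K B.
Proof.
pose P B := (B \subset K) && stable B.
have P0 : P set0 by rewrite /P sub0set stable0.
have [B /maxsetP [/andP [BK sB] maxB] _] := maxset_exists P0.
exists B; split=> // x /setDP [xK xB].
have [[_ /set1P -> //]|xB_apart] := adj_or_anticomplete [set x] B.
suff BE : x |: B = B by rewrite -BE setU11 in xB.
apply: maxB; last exact: subsetUr.
by rewrite /P subUset sub1set xK BK (stableU (stable1 x) sB).
Qed.

Lemma clique_leq_omega C : clique C -> #|C| <= omega G.
Proof. by move=> cC; apply: (@leq_bigmax_cond _ (@clique G) (fun S => #|S|)). Qed.

Lemma omega_attained : exists2 K : {set G}, clique K & #|K| = omega G.
Proof.
have c0 : clique (set0 : {set G}) by apply/cliqueP => x; rewrite inE.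
have [|K cK omegaE] := @eq_bigmax_cond _ (@clique G) (fun S => #|S|).
  by apply/card_gt0P; exists set0.
by exists K.
Qed.

Lemma leq_omega_colorable k : colorable G k -> omega G <= k.
Proof.
case/existsP=> c /forallP cP; apply/bigmax_leqP => S /cliqueP cS.
rewrite -[k]card_ord -(@card_in_imset _ _ c S); first exact: max_card.
move=> x y xS yS cxy; apply/eqP; apply/idPn => xy.
by have := implyP (forallP (cP x) y) (cS x y xS yS xy); rewrite cxy eqxx.
Qed.

Lemma colorable_chi_omega : colorable G (omega G) -> chi G = omega G.
Proof.
move=> colG; rewrite /chi; case: ex_minnP => k colk kmin.
by apply/eqP; rewrite eqn_leq kmin //=; apply: leq_omega_colorable.
Qed.

End CliquesAndStableSets.

Section CliqueTransversals.

Variable G : sgraph.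
Implicit Types (x y z : G) (A C S : {set G}).

Lemma clique_induced S (C : {set induced S}) : clique (val @: C) = clique C.
Proof.
apply/cliqueP/cliqueP => cC x y.
  by move=> xC yC xy; apply: cC; rewrite ?imset_f // (inj_eq val_inj).
move=> /imsetP [u uC ->] /imsetP [v vC ->] uv.
by apply: cC; rewrite // -(inj_eq val_inj).
Qed.

Lemma leq_omega_induced S C : C \subset S -> clique C -> #|C| <= omega (induced S).
Proof.
move=> CS cC; pose C' : {set induced S} := [set x | val x \in C].
have CE : val @: C' = C.
  apply/setP => x; apply/imsetP/idP => [[y]|xC]; first by rewrite inE => yC ->.
  by exists (exist _ x (subsetP CS x xC)); rewrite ?inE.
rewrite -CE card_imset; last exact: val_inj.
by apply: clique_leq_omega; rewrite -clique_induced CE.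
Qed.

Definition max_clique_in S C :=
  [/\ C \subset S, clique C & #|C| = omega (induced S)].

Lemma max_clique_in_exists S : exists C, max_clique_in S C.
Proof.
have [C cC cardC] := omega_attained (induced S); exists (val @: C); split.
- by apply/subsetP=> _ /imsetP [x _ ->]; apply: valP.
- by rewrite clique_induced.
- by rewrite -cardC; apply/card_imset/val_inj.
Qed.

Lemma max_clique_mem S C x :
  max_clique_in S C -> x \in S -> {in C, forall y, y != x -> adj x y} -> x \in C.
Proof.
move=> [CS cC maxC] xS xC; apply/idPn => nxC.
have xCS : x |: C \subset S by rewrite subUset sub1set xS.
by have := leq_omega_induced xCS (clique_setU1 cC xC); rewrite cardsU1 nxC maxC ltnn.
Qed.

Lemma omega2_triangle_free S x y z :
  omega (induced S) <= 2 -> x \in S -> y \in S -> z \in S ->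
  adj x y -> adj x z -> adj y z -> False.
Proof.
move=> omega2 xS yS zS xy xz yz.
have xyzS : x |: [set y; z] \subset S by rewrite !subUset !sub1set xS yS zS.
have := leq_trans (leq_omega_induced xyzS (clique3 xy xz yz)) omega2.
by rewrite cardsU1 !inE cards2 negb_or !adj_neq.
Qed.

Definition clique_transversal S A :=
  [/\ A \subset S, stable A & forall C, max_clique_in S C -> C :&: A != set0].

Lemma omega_setD_transversal_lt S A :
  clique_transversal S A -> omega (induced (S :\: A)) < omega (induced S).
Proof.
move=> [_ _ meetA]; have [C [CSA cC <-]] := max_clique_in_exists (S :\: A).
have CS : C \subset S := subset_trans CSA (subsetDl S A).
rewrite ltn_neqAle leq_omega_induced // andbT; apply/eqP => maxC.
have /set0Pn [x /setIP [xC xA]] := meetA C (And3 CS cC maxC).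
by have := subsetP CSA x xC; rewrite inE xA.
Qed.

Hypothesis transversals : forall S, S != set0 -> exists A, clique_transversal S A.

Lemma transversal_coloring S :
  exists2 f : G -> nat, {in S, forall x, f x < omega (induced S)} &
    {in S &, forall x y, adj x y -> f x != f y}.
Proof.
have [n] := ubnP #|S|; elim: n S => // n IHn S leSn.
have [->|S0] := eqVneq S set0; first by exists (fun=> 0) => x; rewrite inE.
have [A trA] := transversals S0; have [AS sA meetA] := trA.
have ltD : #|S :\: A| < n.
  rewrite ltnS in leSn; apply: leq_trans leSn; apply: proper_card.
  apply/properP; split; first exact: subsetDl.
  have [C maxC] := max_clique_in_exists S.
  have /set0Pn [x /setIP [_ xA]] := meetA C maxC.
  by exists x; rewrite ?inE ?xA // (subsetP AS).
have [f f_lt f_proper] := IHn (S :\: A) ltD.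
have lt_omega := omega_setD_transversal_lt trA.
exists (fun x => if x \in A then omega (induced (S :\: A)) else f x).
  move=> x xS; case: ifPn => // xA; apply: ltn_trans lt_omega.
  by apply: f_lt; rewrite inE xA.
move=> x y xS yS xy; case: ifPn => xA; case: ifPn => yA.
- by rewrite (negbTE (stableP _ sA _ _ xA yA)) in xy.
- by rewrite gtn_eqF // f_lt // inE yA.
- by rewrite ltn_eqF // f_lt // inE xA.
- by apply: f_proper; rewrite ?inE ?xA ?yA.
Qed.

Lemma transversal_perfect : perfect G.
Proof.
move=> S; apply: colorable_chi_omega.
have [f f_lt f_proper] := transversal_coloring S.
apply/existsP; exists [ffun x : induced S => Ordinal (f_lt (val x) (valP x))].
apply/forallP => x; apply/forallP => y; apply/implyP => xy; rewrite !ffunE.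
exact: f_proper (valP x) (valP y) xy.
Qed.

End CliqueTransversals.

Section DiamondFree.

Variable G : sgraph.
Implicit Types (c u : G) (K X Y : {set G}).
Hypothesis diaG : free diamond G.

Lemma diamond_free_dominating X Y c :
  complete X Y -> ~~ stable X -> c \in Y -> dominates c (X :|: Y).
Proof.
move=> XY /forall_inPn [x xX /forall_inPn [x' x'X]]; rewrite negbK => xx' cY z.
case/setUP => [zX _|zY zc]; first by rewrite adj_sym XY.
by apply: (diamond_free_adj diaG xx'); rewrite ?XY // eq_sym.
Qed.

Lemma diamond_free_join X Y :
  X != set0 -> Y != set0 -> complete X Y ->
  stable X && stable Y \/ exists2 c, c \in X :|: Y & dominates c (X :|: Y).
Proof.
move=> /set0Pn [x xX] /set0Pn [y yY] XY.
have [sX|nsX] := boolP (stable X); last first.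
  right; exists y; first by rewrite inE yY orbT.
  exact: diamond_free_dominating XY nsX yY.
have [sY|nsY] := boolP (stable Y); first by left.
right; exists x; first by rewrite inE xX.
by rewrite setUC; apply: diamond_free_dominating (completeC XY) nsY xX.
Qed.

Lemma max_clique_nbrs K u :
  clique K -> #|K| = omega G -> u \notin K -> #|nbrs_in K u| <= 1.
Proof.
move=> cK maxK uK; apply/card_le1_eqP => v v'.
rewrite !inE => /andP [vK uv] /andP [v'K uv']; apply/esym/eqP/idPn => vv'.
suff /clique_leq_omega : clique (u |: K) by rewrite cardsU1 uK maxK ltnn.
apply: clique_setU1 => // w wK _.
have [->//|wv] := eqVneq w v; have [->//|wv'] := eqVneq w v'.
have adjK := cliqueP _ cK.
apply: (diamond_free_adj diaG (adjK v v' vK v'K vv')).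
- by rewrite adj_sym.
- by rewrite adj_sym.
- by rewrite adjK // eq_sym.
- by rewrite adjK // eq_sym.
- by apply: contraNneq uK => ->.
Qed.

End DiamondFree.

Section FeetInClique.

Variables (G : sgraph) (K : {set G}).
Implicit Types (v p q r s : G).
Hypotheses (C5G : free (cycle_graph 5) G) (cliqueK : clique K).

Lemma P3_foot_middle p q r v v' :
  #|nbrs_in K p| <= 1 -> #|nbrs_in K r| <= 1 ->
  adj p q -> adj q r -> ~~ adj p r ->
  v \in K -> v' \in K -> adj p v -> adj r v' -> v != v' -> adj q v || adj q v'.
Proof.
move=> footp footr pq qr npr vK v'K pv rv' vv'.
have npv' : ~~ adj p v'.
  by apply: contra vv' => pv'; rewrite (nbrs_in_uniq footp vK v'K).
have nrv : ~~ adj r v.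
  by apply: contra vv' => rv; rewrite (nbrs_in_uniq footr vK v'K).
have v'v : adj v' v by rewrite adj_sym (cliqueP _ cliqueK).
have vp : adj v p by rewrite adj_sym.
have := C5_free_chord C5G pq qr rv' v'v vp.
by rewrite (negbTE npr) (negbTE npv') (negbTE nrv) orbF /= orbC.
Qed.

Lemma card_nbrs_in_P3 p q r :
  #|nbrs_in K p| <= 1 -> #|nbrs_in K q| <= 1 -> #|nbrs_in K r| <= 1 ->
  adj p q -> adj q r -> ~~ adj p r ->
  #|nbrs_in K p :|: nbrs_in K q :|: nbrs_in K r| <= 2.
Proof.
move=> footp footq footr pq qr npr.
have [/setUidPr ->|/subsetPn [v]] := boolP (nbrs_in K p \subset nbrs_in K q).
  exact: (@leq_card_setU2 _ _ _ 1 1).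
rewrite !inE => /andP [vK pv]; rewrite vK /= => nqv.
rewrite -setUA.
have [/setUidPl ->|/subsetPn [v']] := boolP (nbrs_in K r \subset nbrs_in K q).
  exact: (@leq_card_setU2 _ _ _ 1 1).
rewrite !inE => /andP [v'K rv']; rewrite v'K /= => nqv'.
have vv' : v = v'.
  apply/eqP/idPn => neq.
  have := P3_foot_middle footp footr pq qr npr vK v'K pv rv' neq.
  by rewrite (negbTE nqv) (negbTE nqv').
suff /setUidPl rp : nbrs_in K r \subset nbrs_in K p.
  by rewrite setUCA rp; apply: (@leq_card_setU2 _ _ _ 1 1).
apply/subsetP=> u; rewrite !inE => /andP [uK ru].
by rewrite uK -(nbrs_in_uniq footr v'K uK rv' ru) -vv'.
Qed.

(* A P4 outside K has at most three feet by card_nbrs_in_P3, so it misses an edge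
   of K and forms a P2 + P4 with it. *)
Lemma P4_free_on_setC :
  free (disjoint_union (path_graph 2) (path_graph 4)) G -> 5 <= #|K| ->
  {in ~: K, forall u, #|nbrs_in K u| <= 1} -> P4_free_on (@adj G) (~: K).
Proof.
move=> PG K5 foot p q r s /and5P [pK qK rK sK _]; apply/negP => P4.
have /and5P [pq qr rs npr _] := P4.
pose feet := nbrs_in K p :|: nbrs_in K q :|: nbrs_in K r :|: nbrs_in K s.
have feet3 : #|feet| <= 2 + 1.
  by apply: leq_card_setU2; [apply: card_nbrs_in_P3; rewrite ?foot|apply: foot].
have feetK : feet \subset K by rewrite !subUset !subsetIl.
have cardK := cardsID feet K; rewrite (setIidPr feetK) in cardK.
have /card_gt1P [v [v' [vK v'K vv']]] : 1 < #|K :\: feet|.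
  rewrite -(leq_add2l #|feet|) cardK.
  by apply: leq_trans K5; rewrite addn2 !ltnS.
have [/setDP [vK' _] /setDP [v'K' _]] := (vK, v'K).
have /negP := P2P4_free_linked PG (cliqueP _ cliqueK v v' vK' v'K' vv') P4; apply.
apply/allrelP => x y xvv' y_P4.
have /setDP [xK] : x \in K :\: feet.
  by move: xvv'; rewrite in_cons mem_seq1 => /orP [] /eqP ->.
apply: contra => xy; move: y_P4; rewrite /feet !inE xK /=.
by case/or4P => /eqP <-; rewrite (adj_sym y) xy ?orbT.
Qed.

End FeetInClique.

Section TransversalConstruction.

(* B is a single vertex of K, or empty if K is. *)
Variables (G : sgraph) (S K B : {set G}).
Implicit Types (c x y u v : G) (A C T X Y : {set G}).

Hypotheses (diaG : free diamond G) (C5G : free (cycle_graph 5) G).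
Hypotheses (S0 : S != set0) (KS : K \subset S) (cliqueK : clique K).
Hypothesis footK : {in S :\: K, forall u, #|nbrs_in K u| <= 1}.
Hypothesis maxB : maximal_stable_in K B.

Let BK : B \subset K. Proof. by case: maxB. Qed.
Let stableB : stable B. Proof. by case: maxB. Qed.

Lemma base_uniq : {in B &, forall u v, u = v}.
Proof.
move=> u v uB vB; have := clique_stable_card_le1 cliqueK stableB.
by rewrite (setIidPr BK) => /card_le1_eqP; apply.
Qed.

Lemma foot_uniq u v v' :
  u \in S :\: K -> v \in K -> v' \in K -> adj u v -> adj u v' -> v = v'.
Proof. by move=> /footK; apply: nbrs_in_uniq. Qed.

Lemma clique_card_setIK C q : clique C -> q \in C -> q \in S :\: K -> #|C :&: K| <= 1.
Proof.
move=> cC qC qSK; apply: leq_trans (footK qSK); apply/subset_leq_card/subsetP => v.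
case/setIP => vC vK; rewrite !inE vK (cliqueP _ cC) //.
by apply: contraTneq vK => <-; case/setDP: qSK.
Qed.

Definition partial_transversal T A :=
  [/\ A \subset T, stable (B :|: A) &
    forall C, max_clique_in S C -> C \subset K :|: T -> C :&: (B :|: A) != set0].

Lemma max_clique_sub_K_meets C : max_clique_in S C -> C \subset K -> C :&: B != set0.
Proof.
move=> maxC CK; have [CS cC cardC] := maxC.
have CE : C = K by apply/eqP; rewrite eqEcard CK cardC leq_omega_induced.
have [x xC] : exists x, x \in C.
  apply/set0Pn; rewrite -card_gt0 cardC; have /set0Pn [x xS] := S0.
  by rewrite -(cards1 x) leq_omega_induced ?sub1set // clique1.
have [_ _ domB] := maxB; rewrite CE in xC *; apply/set0Pn.
have [xB|xB] := boolP (x \in B); first by exists x; rewrite inE xC.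
have [|y yB _] := domB x; first by rewrite inE xB.
by exists y; rewrite inE yB (subsetP BK).
Qed.

Lemma partial_transversal_of_meets T A :
  T \subset S :\: K -> A \subset T -> stable A -> anticomplete B A ->
  (forall C q, max_clique_in S C -> C \subset K :|: T -> q \in C -> q \in T ->
    C :&: (B :|: A) != set0) ->
  partial_transversal T A.
Proof.
move=> TSK AT sA BA meetT; split=> // [|C maxC CKT]; first exact: stableU.
have [CK|/subsetPn [q qC qK]] := boolP (C \subset K).
  have := max_clique_sub_K_meets maxC CK.
  by case/set0Pn => x /setIP [xC xB]; apply/set0Pn; exists x; rewrite !inE xC xB.
apply: (meetT C q) => //; have /setUP [] := subsetP CKT q qC => //.
by rewrite (negbTE qK).
Qed.

Lemma partial_transversal_set0 : partial_transversal set0 set0.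
Proof.
apply: partial_transversal_of_meets; rewrite ?sub0set //.
- exact: stable0.
- by move=> x y _; rewrite inE.
- by move=> C q _ _ _; rewrite inE.
Qed.

Lemma partial_transversalU T1 T2 A1 A2 :
  anticomplete T1 T2 ->
  partial_transversal T1 A1 -> partial_transversal T2 A2 ->
  partial_transversal (T1 :|: T2) (A1 :|: A2).
Proof.
move=> T12 [A1T sA1 meet1] [A2T sA2 meet2]; split; first exact: setUSS.
  rewrite setUA; apply: stableU sA1 (sub_stable (subsetUr B A2) sA2) _ => x y.
  case/setUP=> [xB|xA1] yA2; first by rewrite (stableP _ sA2) // inE (xB, yA2) ?orbT.
  by apply: T12; [apply: (subsetP A1T)|apply: (subsetP A2T)].
move=> C maxC CKT; have [_ cC _] := maxC.
have [|/pred0Pn [x /= /andP [xC xT1]]] := boolP [disjoint C & T1].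
  move=> C1; suff /(meet2 C maxC) /set0Pn [x /setIP [xC xA]] : C \subset K :|: T2.
    by apply/set0Pn; exists x; rewrite inE xC setUCA inE xA orbT.
  apply/subsetP=> x xC; move: (subsetP CKT x xC).
  by rewrite setUCA inE (disjointFr C1 xC).
suff /(meet1 C maxC) /set0Pn [y /setIP [yC yA]] : C \subset K :|: T1.
  by apply/set0Pn; exists y; rewrite inE yC setUA inE yA.
apply/subsetP=> y yC; have := subsetP CKT y yC.
rewrite setUA inE => /orP [//|yT2].
have [<-|xy] := eqVneq x y; first by rewrite inE xT1 orbT.
by have := cliqueP _ cC x y xC yC xy; rewrite (negbTE (T12 x y xT1 yT2)).
Qed.

(* Without c, the clique C would contain two vertices x and y outside K. The edge xy
   forms triangles with c and with every other vertex of C, so by diamond-freeness c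
   could be added to C. *)
Lemma dominating_mem_max_clique T c C q :
  T \subset S :\: K -> c \in T -> dominates c T ->
  (T != [set c] -> 2 < omega (induced S)) ->
  max_clique_in S C -> C \subset K :|: T -> q \in C -> q \in T -> c \in C.
Proof.
move=> TSK cT domc omega3 maxC CKT qC qT; apply/idPn => cC.
have [_ cliqueC cardC] := maxC.
have neq_c x : x \in C -> x != c by apply: contraTneq => ->.
have lt2C : 2 < #|C|.
  rewrite cardC omega3 //; apply: contraTneq qT => ->; rewrite inE; exact: neq_c.
have /card_gt1P [x [y [xCK yCK xy]]] : 1 < #|C :\: K|.
  have leCK := clique_card_setIK cliqueC qC (subsetP TSK q qT).
  move: lt2C; rewrite -(cardsID K C) !ltnNge; apply: contra; exact: leq_add leCK.
have memT z : z \in C :\: K -> z \in C /\ z \in T.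
  by case/setDP => zC zK; have := subsetP CKT z zC; rewrite inE (negbTE zK).
have [[xC xT] [yC yT]] := (memT x xCK, memT y yCK).
move/negP: cC; apply; apply: (max_clique_mem maxC).
  by have /setDP [] := subsetP TSK c cT.
move=> v vC vc; have adjC := cliqueP _ cliqueC.
have [->|vx] := eqVneq v x; first by rewrite domc ?neq_c.
have [->|vy] := eqVneq v y; first by rewrite domc ?neq_c.
apply: (diamond_free_adj diaG (adjC x y xC yC xy)); rewrite ?(adjC _ v) 1?eq_sym //.
- by rewrite adj_sym domc ?neq_c.
- by rewrite adj_sym domc ?neq_c.
Qed.

Lemma partial_transversal_dominated_apart T c :
  T \subset S :\: K -> c \in T -> dominates c T ->
  (T != [set c] -> 2 < omega (induced S)) -> {in B, forall v, ~~ adj c v} ->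
  partial_transversal T [set c].
Proof.
move=> TSK cT domc omega3 cB.
apply: partial_transversal_of_meets => // [|||C q maxC CKT qC qT].
- by rewrite sub1set.
- exact: stable1.
- by move=> v _ vB /set1P ->; rewrite adj_sym cB.
- have cC := dominating_mem_max_clique TSK cT domc omega3 maxC CKT qC qT.
  by apply/set0Pn; exists c; rewrite !inE cC eqxx orbT.
Qed.

Lemma partial_transversal_dominated_adj T c v A :
  T \subset S :\: K -> c \in T -> dominates c T ->
  (T != [set c] -> 2 < omega (induced S)) -> v \in B -> adj c v ->
  maximal_stable_in [set x in T | (x != c) && ~~ adj x v] A ->
  partial_transversal T A.
Proof.
move=> TSK cT domc omega3 vB cv [AT sA domA].
have memA x : x \in A -> [/\ x \in T, x != c & ~~ adj x v].
  by move=> /(subsetP AT); rewrite inE => /and3P.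
have inSK x : x \in T -> x \in S /\ x \notin K by move=> /(subsetP TSK) /setDP.
have vK := subsetP BK v vB.
apply: partial_transversal_of_meets => // [||C q maxC CKT qC qT].
- by apply/subsetP => x /memA [].
- by move=> w x /base_uniq /(_ vB) -> /memA [_ _]; rewrite adj_sym.
have cC := dominating_mem_max_clique TSK cT domc omega3 maxC CKT qC qT.
have [_ cliqueC _] := maxC; apply/set0Pn.
have [vC|vC] := boolP (v \in C); first by exists v; rewrite !inE vC vB.
have CT x : x \in C -> x \in T.
  move=> xC; have /setUP [xK|//] := subsetP CKT x xC.
  have xc : c != x by apply: contraTneq xK => <-; case: (inSK c cT).
  have cx := cliqueP _ cliqueC c x cC xC xc.
  by rewrite (foot_uniq (subsetP TSK c cT) vK xK cv cx) xC in vC.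
have /exists_inP [x xC nxv] : [exists x in C, ~~ adj x v].
  apply: contraR vC => /exists_inPn adj_v; apply: (max_clique_mem maxC).
    exact: subsetP KS v vK.
  by move=> x /adj_v; rewrite negbK adj_sym.
have xc : x != c by apply: contraNneq nxv => ->.
have cx := domc x (CT x xC) xc.
have [xA|xA] := boolP (x \in A); first by exists x; rewrite !inE xC xA orbT.
have [|a aA xa] := domA x; first by rewrite !inE xA CT // xc.
have [aT ac _] := memA a aA.
exists a; rewrite !inE aA orbT andbT; apply: (max_clique_mem maxC).
  by case: (inSK a aT).
move=> z zC za; have [->|zc] := eqVneq z c; first by rewrite adj_sym domc.
have [->|zx] := eqVneq z x; first by rewrite adj_sym.
apply: (diamond_free_adj diaG cx) => //; first exact: domc.
- by rewrite domc // CT.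
- by rewrite (cliqueP _ cliqueC) // eq_sym.
- by rewrite eq_sym.
Qed.

Lemma partial_transversal_dominated T c :
  T \subset S :\: K -> c \in T -> dominates c T ->
  (T != [set c] -> 2 < omega (induced S)) -> exists A, partial_transversal T A.
Proof.
move=> TSK cT domc omega3.
have [/exists_inP [v vB cv]|/exists_inPn cB] := boolP [exists v in B, adj c v].
  have [A maxA] := maximal_stable_exists [set x in T | (x != c) && ~~ adj x v].
  by exists A; apply: partial_transversal_dominated_adj maxA.
by exists [set c]; apply: partial_transversal_dominated_apart.
Qed.

Lemma partial_transversal_apart_side X Y :
  X :|: Y \subset S :\: K -> stable X -> stable Y -> 2 < omega (induced S) ->
  partial_transversal (X :|: Y) [set x in X | [forall v in B, ~~ adj x v]].
Proof.
move=> XYSK sX sY omega3; set A := [set x in X | _].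
have AX : A \subset X by apply/subsetP => x; rewrite inE => /andP [].
apply: partial_transversal_of_meets => // [|||C q maxC CKXY qC qT].
- exact: subset_trans AX (subsetUl X Y).
- exact: sub_stable AX sX.
- by move=> v x vB; rewrite inE adj_sym => /andP [_ /forall_inP]; apply.
have [_ cliqueC cardC] := maxC.
have uncovered Z1 Z2 :
    C \subset Z1 :|: Z2 -> #|C :&: Z1| <= 1 -> #|C :&: Z2| <= 1 -> False.
  move=> CZ C1 C2; have := leq_card_setU2 C1 C2.
  by rewrite -setIUr (setIidPl CZ) cardC leqNgt omega3.
have CK := clique_card_setIK cliqueC qC (subsetP XYSK q qT).
have CX := clique_stable_card_le1 cliqueC sX.
have CY := clique_stable_card_le1 cliqueC sY.
have [x xC xX] : exists2 x, x \in C & x \in X.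
  apply/exists_inP; apply: contraT => /exists_inPn nX; case: (uncovered K Y) => //.
  apply/subsetP => x xC.
  by move: (subsetP CKXY x xC); rewrite !inE (negbTE (nX x xC)).
have [u uC uK] : exists2 u, u \in C & u \in K.
  apply/exists_inP; apply: contraT => /exists_inPn nK; case: (uncovered X Y) => //.
  apply/subsetP => u uC.
  by move: (subsetP CKXY u uC); rewrite !inE (negbTE (nK u uC)).
apply/set0Pn; have [xA|xA] := boolP (x \in A).
  by exists x; rewrite inE xC inE xA orbT.
have xSK : x \in S :\: K by apply: (subsetP XYSK); rewrite inE xX.
move: xA; rewrite inE xX => /forall_inPn [v vB]; rewrite negbK => xv.
have xu : adj x u.
  by apply: (cliqueP _ cliqueC) => //; apply: contraTneq uK => <-; case/setDP: xSK.
by exists u; rewrite !inE uC (foot_uniq xSK uK (subsetP BK v vB) xu xv) vB.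
Qed.

Lemma partial_transversal_one_side X Y :
  X :|: Y \subset S :\: K -> stable X -> stable Y -> 1 < omega (induced S) ->
  anticomplete B X -> anticomplete Y (K :\: B) ->
  partial_transversal (X :|: Y) X.
Proof.
move=> XYSK sX sY omega2 BX YK.
apply: partial_transversal_of_meets => // [|C q maxC CKXY qC qXY].
  exact: subsetUl.
have [_ cliqueC cardC] := maxC; apply/set0Pn.
have /setUP [qX|qY] := qXY; first by exists q; rewrite !inE qC qX orbT.
have /card_gt0P [z /setD1P [zq zC]] : 0 < #|C :\ q|.
  by move: omega2; rewrite -cardC (cardsD1 q C) qC.
have qz : adj q z by apply: (cliqueP _ cliqueC); rewrite // eq_sym.
exists z; rewrite inE zC /= inE.
have /setUP [zK|/setUP [->|zY]] := subsetP CKXY z zC.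
- apply/orP; left; apply: contraLR qz => zB; apply: YK => //; by rewrite inE zB.
- by rewrite orbT.
- by rewrite (negbTE (stableP _ sY q z qY zY)) in qz.
Qed.

Lemma bipartite_foot_apart X Y x y v :
  X :|: Y \subset S :\: K -> complete_bipartite X Y -> omega (induced S) <= 2 ->
  x \in X -> y \in Y -> v \in K -> adj x v -> ~~ adj y v.
Proof.
rewrite subUset => /andP [XSK YSK] [_ _ XY] omega2 xX yY vK xv; apply/negP.
have /setDP [xS _] := subsetP XSK x xX; have /setDP [yS _] := subsetP YSK y yY.
exact: (omega2_triangle_free omega2 xS yS (subsetP KS v vK) (XY x y xX yY) xv).
Qed.

Lemma bipartite_foot_uniq X Y x x' v v' :
  X :|: Y \subset S :\: K -> complete_bipartite X Y -> omega (induced S) <= 2 ->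
  Y != set0 -> x \in X -> x' \in X -> v \in K -> v' \in K ->
  adj x v -> adj x' v' -> v = v'.
Proof.
move=> XYSK bipXY omega2 /set0Pn [y yY] xX x'X vK v'K xv x'v'.
have [sX _ XY] := bipXY; apply/eqP/idPn => vv'.
have foot1 z : z \in X -> #|nbrs_in K z| <= 1.
  by move=> zX; apply/footK/(subsetP XYSK); rewrite inE zX.
have := P3_foot_middle C5G cliqueK (foot1 x xX) (foot1 x' x'X)
  (XY x y xX yY) (completeC XY yY x'X) (stableP _ sX x x' xX x'X)
  vK v'K xv x'v' vv'.
have apart := bipartite_foot_apart XYSK bipXY omega2.
rewrite (negbTE (apart x y v xX yY vK xv)).
by rewrite (negbTE (apart x' y v' x'X yY v'K x'v')).
Qed.

Lemma partial_transversal_opposite_side X Y x v :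
  X :|: Y \subset S :\: K -> complete_bipartite X Y -> omega (induced S) = 2 ->
  Y != set0 -> x \in X -> v \in B -> adj x v -> partial_transversal (Y :|: X) Y.
Proof.
move=> XYSK bipXY omegaE Y0 xX vB xv; have [sX sY _] := bipXY.
have omega2 : omega (induced S) <= 2 by rewrite omegaE.
have vK := subsetP BK v vB.
apply: partial_transversal_one_side; rewrite 1?setUC ?omegaE //.
- move=> u y uB yY; rewrite (base_uniq uB vB) adj_sym.
  exact: bipartite_foot_apart XYSK bipXY omega2 xX yY vK xv.
- move=> x' u x'X /setDP [uK uB]; apply: contra uB => x'u.
  by rewrite -(bipartite_foot_uniq XYSK bipXY omega2 Y0 xX x'X vK uK xv x'u).
Qed.

Lemma partial_transversal_triangle_free X Y :
  X :|: Y \subset S :\: K -> complete_bipartite X Y -> omega (induced S) = 2 ->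
  X != set0 -> Y != set0 -> exists A, partial_transversal (X :|: Y) A.
Proof.
move=> XYSK bipXY omegaE X0 Y0; have [sX sY _] := bipXY.
have YXSK : Y :|: X \subset S :\: K by rewrite setUC.
have [[x xX [v vB xv]]|XB] := adj_or_anticomplete X B.
  exists Y; rewrite setUC.
  exact: partial_transversal_opposite_side XYSK bipXY omegaE Y0 xX vB xv.
have [[y yY [v vB yv]]|YB] := adj_or_anticomplete Y B.
  exists X; have bipYX := complete_bipartiteC bipXY.
  exact: partial_transversal_opposite_side YXSK bipYX omegaE X0 yY vB yv.
have [[y yY [u uKB yu]]|YK] := adj_or_anticomplete Y (K :\: B); last first.
  exists X; apply: partial_transversal_one_side; rewrite ?omegaE //.
  exact: anticompleteC.
exists Y; rewrite setUC; apply: partial_transversal_one_side; rewrite ?omegaE //.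
  exact: anticompleteC.
have [_ _ /(_ u uKB) [v vB uv]] := maxB.
have [/setDP [uK _] vK] := (uKB, subsetP BK v vB).
move=> x w xX /setDP [wK wB]; apply/negP => xw.
have uw : u != w.
  apply: contraTneq yu => ->.
  by apply: bipartite_foot_apart XYSK bipXY _ xX yY wK xw; rewrite omegaE.
have wv : adj w v.
  by apply: (cliqueP _ cliqueK) => //; apply: contraNneq wB => ->.
have omega2 : omega (induced S) <= 2 by rewrite omegaE.
have inS := subsetP KS; have adj_uw := cliqueP _ cliqueK u w uK wK uw.
exact: (omega2_triangle_free omega2 (inS u uK) (inS w wK) (inS v vK) adj_uw uv wv).
Qed.

Lemma partial_transversal_join X Y :
  X :|: Y \subset S :\: K -> X != set0 -> Y != set0 ->
  complete X Y -> exists A, partial_transversal (X :|: Y) A.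
Proof.
move=> XYSK X0 Y0 XY; have [omega2|omega3] := leqP (omega (induced S)) 2.
  have inS z : z \in X :|: Y -> z \in S by move=> /(subsetP XYSK) /setDP [].
  have XS x : x \in X -> x \in S by move=> xX; apply: inS; rewrite inE xX.
  have YS y : y \in Y -> y \in S by move=> yY; apply: inS; rewrite inE yY orbT.
  have [[x xX] [y yY]] := (set0Pn _ X0, set0Pn _ Y0).
  have triangle_free := omega2_triangle_free omega2.
  apply: partial_transversal_triangle_free => //.
    split=> //; apply/stableP => u v uZ vZ; apply/negP => uv.
      have [uy vy] := (XY u y uZ yY, XY v y vZ yY).
      exact: triangle_free (XS u uZ) (XS v vZ) (YS y yY) uv uy vy.
    have [xu xv] := (XY x u xX uZ, XY x v xX vZ).
    exact: triangle_free (XS x xX) (YS u uZ) (YS v vZ) xu xv uv.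
  have xy := XY x y xX yY; apply/eqP; rewrite eqn_leq omega2.
  have <- : #|[set x; y]| = 2 by rewrite cards2 (adj_neq xy).
  apply: leq_omega_induced; first by rewrite subUset !sub1set XS ?YS.
  exact: clique2.
have [/andP [sX sY]|[c cXY domc]] := diamond_free_join diaG X0 Y0 XY.
  by eexists; apply: partial_transversal_apart_side.
exact: partial_transversal_dominated cXY domc _.
Qed.

Lemma partial_transversal_exists T :
  P4_free_on (@adj G) (S :\: K) -> T \subset S :\: K ->
  exists A, partial_transversal T A.
Proof.
move=> P4SK; have [n] := ubnP #|T|; elim: n T => // n IHn T leTn TSK.
rewrite ltnS in leTn; have [T1|T1] := ltnP 1 #|T|; last first.
  have [->|[c cT]] := set_0Vmem T.
    by exists set0; apply: partial_transversal_set0.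
  have TE : T = [set c] by apply/eqP; rewrite eq_sym eqEcard sub1set cT cards1.
  apply: (@partial_transversal_dominated T c) => // [z|]; last by rewrite -TE eqxx.
  by rewrite TE => /set1P ->; rewrite eqxx.
have [b [X cutX]] :=
  P4_free_homogeneous_cut (@adj_sym G) T1 (P4_free_onS TSK P4SK).
have [[XT X0 adjX] [YT Y0 _]] := (cutX, homogeneous_cutC (@adj_sym G) cutX).
have TE : X :|: T :\: X = T by rewrite -{1}(setIidPr (proper_sub XT)) setID.
have smaller (Z : {set G}) : Z \proper T -> exists A, partial_transversal Z A.
  move=> ZT; apply: IHn; first exact: leq_trans (proper_card ZT) leTn.
  exact: subset_trans (proper_sub ZT) TSK.
rewrite -TE; case: b {cutX} adjX => adjX.
  by apply: partial_transversal_join; rewrite ?TE.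
have [[A1 transvX] [A2 transvY]] := (smaller X XT, smaller _ YT).
by exists (A1 :|: A2); apply: partial_transversalU => // x z xX zY; rewrite adjX.
Qed.

Lemma clique_transversal_exists :
  P4_free_on (@adj G) (S :\: K) -> exists A, clique_transversal S A.
Proof.
move=> P4SK; have [A [ASK sBA meetA]] := partial_transversal_exists P4SK (subxx _).
have KE : K :|: S :\: K = S by rewrite -{1}(setIidPr KS) setID.
exists (B :|: A); split=> //.
  by rewrite subUset (subset_trans BK KS) (subset_trans ASK (subsetDl S K)).
by move=> C maxC; apply: meetA; rewrite // KE; case: maxC.
Qed.

End TransversalConstruction.

Lemma attached_clique_perfect (G : sgraph) (K : {set G}) :
  free diamond G -> free (cycle_graph 5) G -> clique K ->
  {in ~: K, forall u, #|nbrs_in K u| <= 1} -> P4_free_on (@adj G) (~: K) -> perfect G.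
Proof.
move=> diaG C5G cK footK P4K; apply: transversal_perfect => S S0.
have SK : S :\: (K :&: S) \subset ~: K.
  by rewrite setDIr setDv setU0 subsetDr.
have [B maxB] := maximal_stable_exists (K :&: S).
apply: (@clique_transversal_exists _ S (K :&: S) B) => //.
- exact: subsetIr.
- exact: sub_clique (subsetIl K S) cK.
- move=> u /(subsetP SK) /footK; apply: leq_trans.
  exact/subset_leq_card/setSI/subsetIl.
- exact: P4_free_onS SK P4K.
Qed.

Theorem theorem1p4 (G : sgraph)
  (hP2P4 : free (disjoint_union (path_graph 2) (path_graph 4)) G)
  (hdiamond : free diamond G)
  (hC5 : free (cycle_graph 5) G)
  (homega : 5 <= omega G) :
  perfect G.
Proof.
have [K cliqueK maxK] := omega_attained G.
have footK : {in ~: K, forall u, #|nbrs_in K u| <= 1}.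
  by move=> u; rewrite inE; apply: max_clique_nbrs.
apply: (attached_clique_perfect hdiamond hC5 cliqueK footK).
by apply: P4_free_on_setC; rewrite ?maxK.
Qed.
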